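(* Let $\alpha\in\Lambda^q(\mathbb R^{q+r})^*$ be a calibration with constant coefficients (with respect to the standard metric) such that $\mathbb R^q=\mathbb R^q\times\{0\}\subseteq\mathbb R^{q+r}$ is calibrated, and suppose that $\alpha$ satisfies the equality property for some $\chi\in\Lambda^q(\mathbb R^{q+r})^*\otimes E$, where $E$ is a Euclidean vector space. Let $B\subseteq\mathbb R^q$ be a contractible open set and denote again by $\alpha,\chi$ the induced constant-coefficient forms on $B\times T^r$. Let $H$ be the standard horizontal distribution induced by $B$ on $B\times T^r$ and $V$ its orthogonal complement. Given a smooth map $u:B\to T^r$, define the immersion $\iota:B\to B\times T^r$, $x\mapsto(x,u(x))$. Then $\iota$ is positive horizontally projectable. Let $\nabla$ be the real Fourier–Mukai transform of $u$, with curvature $F_\nabla$, and let $\Psi:B\times T^r\to B\times(T^r)^*$ be the diffeomorphism $\Psi(x,[z])=(x,[z/2\pi])$ induced by the standard basis of $\mathbb{R}^r$. Then, for every $b\in B$, $$\beta_{\iota_*(T_bB)}=-2\pi\sqrt{-1}\,(\Psi^*F_\nabla)_{\iota(b)} .$$ Hence $\iota$ is $f$-calibrated (with respect to $\alpha_2$) if and only if $\mathcal P(F_\nabla)=0$, where $f(\pi)=ve(\pi)\,\mathrm{vol}^H_\pi/\mathrm{vol}_\pi$ for $\pi\in G_H^+(q,B\times T^r)$; in the latter condition, $\Psi^*$ is used to view $F_\nabla$ as an element of $(H^*\otimes V^* )\otimes\mathbb C$, and $\mathcal P$ is extended complex-linearly.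
   Context: Tori: $T^r=\mathbb R^r/2\pi\mathbb Z^r$, $(T^r)^*=(\mathbb R^r)^*/(\mathbb Z^r)^*$, with coordinates $y^{q+1},\dots,y^{q+r}$ of period 1 on $(T^r)^*$ from the dual basis. The manifold $M=B\times T^r$ has the flat metric $g$ induced from $\mathbb R^{q+r}$. Real Fourier–Mukai transform of $u$: choosing a lift of $u$ to $B\to\mathbb R^r$ with components $u^a$, it is the Hermitian connection $\nabla=\nabla_u=d+\sqrt{-1}\sum_{a=q+1}^{q+r}u^a(x)\,dy^a$ on the trivial line bundle over $B\times(T^r)^*$, well defined up to gauge; its curvature is $F_\nabla=\sqrt{-1}\sum_{i,a}\frac{\partial u^a}{\partial x^i}dx^i\wedge dy^a$. Calibrations: for oriented $q$-planes $\pi$, $\mathrm{vol}_\pi$ is the metric volume form. A $q$-form $\alpha$ is a calibration if $\alpha|_\pi\le\mathrm{vol}_\pi$ for all oriented $q$-planes $\pi$ and $d\alpha=0$; $\pi$ is calibrated if equality holds. Equality property: $|\alpha(v_1,\dots,v_q)|^2+|\chi(v_1,\dots,v_q)|^2=|v_1\wedge\dots\wedge v_q|^2$ for every $q$-plane and frame $v_1,\dots,v_q$ of it. Let $p_H,p_V$ be the projections for $TM=H\oplus V$; $H$ is oriented by $\alpha$. $G_H^+(q,M)$ is the set of oriented $q$-planes $\pi\subseteq T_xM$ with $p_H|_\pi:\pi\to H_x$ an orientation-preserving isomorphism; $\iota$ is positive horizontally projectable if all its oriented tangent planes lie in $G_H^+(q,M)$. For $\pi\in G_H^+(q,M)$: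 $g^H_\pi:=(p_H|_\pi)^*g$, $\mathrm{vol}^H_\pi$ is its volume form, $ve(\pi)=\frac12\sum_i|p_V(v_i)|^2$ for a $g^H_\pi$-orthonormal basis $\{v_i\}$; $T_\pi:=(p_V|_\pi)\circ(p_H|_\pi)^{-1}\in H_x^*\otimes V_x$ and $\beta_\pi:=g(T_\pi\cdot,\cdot)\in H^*_x\otimes V^*_x\subseteq\Lambda^2T_x^*M$, i.e. $\beta_\pi=\sum_i e^i\wedge T_\pi(e_i)^\flat$ for a basis $\{e_i\}$ of $H_x$ with dual basis $\{e^i\}$. Write $\alpha=\sum_i\alpha_i$, $\chi=\sum_i\chi_i$ with $\alpha_i$ (resp. $\chi_i$) of type $\Lambda^{q-i}H^*\otimes\Lambda^iV^*$ (resp. $E$-valued of this type); components with index $i>q$ vanish. $\iota$ is $f$-calibrated if $\alpha_2|_\pi=f(\pi)\mathrm{vol}_\pi$ on all its tangent planes. The linear map $\mathcal P:H^*\otimes V^*\to E$ is the one expressing the condition $\chi_1|_\pi=0$: identifying $H^*\otimes V^*\cong H^*\otimes V$ by $g$, $\mathcal P(T)=\sum_{i=1}^q\chi(e_1,\dots,e_{i-1},T(e_i),e_{i+1},\dots,e_q)$ for a positive orthonormal basis $\{e_i\}$ of $H$. *)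

(* Defs.v *)
From HB Require Import structures.
From mathcomp Require Import all_boot all_order all_algebra.
From mathcomp Require Import sesquilinear generic_quotient complex.
From mathcomp Require Import all_classical all_reals all_analysis.

Set Implicit Arguments.
Unset Strict Implicit.
Unset Printing Implicit Defensive.

Import Order.TTheory GRing.Theory Num.Theory.
Import numFieldNormedType.Exports.

Local Open Scope classical_set_scope.
Local Open Scope ring_scope.
Local Open Scope complex_scope.

(* A k-tuple of vectors of R^n is a matrix with k rows: k-forms are functions
   on 'M[R]_(k, n).  The sup norm on matrices that the library provides is used
   only for topology and differentiation; lengths, volumes and orthogonality
   are those of the Euclidean product dotv. *)

Section ExteriorAlgebra.
Variable R : realType.

Definition dotv n (u v : 'rV[R]_n) : R := (u *m v^T) 0 0.

(* Same formulation as determinant_multilinear and determinant_alternate. *)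
Definition altform k n (W : lmodType R) (w : 'M[R]_(k, n) -> W) : Prop :=
  (forall (A B C : 'M[R]_(k, n)) (i0 : 'I_k) (b c : R),
      row i0 A = b *: row i0 B + c *: row i0 C ->
      row' i0 B = row' i0 A -> row' i0 C = row' i0 A ->
      w A = b *: w B + c *: w C) /\
  (forall (A : 'M[R]_(k, n)) (i1 i2 : 'I_k),
      i1 != i2 -> A i1 =1 A i2 -> w A = 0).

Definition gram k n (g : 'rV[R]_n -> 'rV[R]_n -> R) (A : 'M[R]_(k, n)) :
    'M[R]_k :=
  \matrix_(i, j) g (row i A) (row j A).

(* |v_1 /\ ... /\ v_k|^2 *)
Definition wedge_norm2 k n (A : 'M[R]_(k, n)) : R := \det (gram (@dotv n) A).

(* An oriented k-plane is identified with the set of its positive frames,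
   which is an orbit of the matrices of positive determinant. *)
Definition oplane_of k n (A : 'M[R]_(k, n)) : set 'M[R]_(k, n) :=
  [set M | exists2 P : 'M[R]_k, 0 < \det P & M = P *m A].

Definition oriented_plane k n (p : set 'M[R]_(k, n)) : Prop :=
  exists2 A, row_free A & p = oplane_of A.

Definition plane_span k n (p : set 'M[R]_(k, n)) : set 'rV[R]_n :=
  [set w | exists2 A, p A & (w <= A)%MS].

(* The volume form of the metric g, evaluated on a positive frame. *)
Definition vol k n (g : 'rV[R]_n -> 'rV[R]_n -> R) (A : 'M[R]_(k, n)) : R :=
  Num.sqrt (\det (gram g A)).

(* Two top-degree forms on a plane are compared on its positive frames. *)
Definition calibrated_plane k n (alpha : 'M[R]_(k, n) -> R^o)
    (p : set 'M[R]_(k, n)) : Prop :=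
  forall A, p A -> alpha A = vol (@dotv n) A.

(* Calibrations with constant coefficients, for which d alpha = 0 holds. *)
Definition calibration k n (alpha : 'M[R]_(k, n) -> R^o) : Prop :=
  altform alpha /\
  forall p, oriented_plane p ->
    forall A, p A -> alpha A <= vol (@dotv n) A.

Definition equality_property k n (E : vectType R) (dotE : {dot E for idfun})
    (alpha : 'M[R]_(k, n) -> R^o) (chi : 'M[R]_(k, n) -> E) : Prop :=
  forall A, row_free A ->
    alpha A ^+ 2 + dotE (chi A) (chi A) = wedge_norm2 A.

End ExteriorAlgebra.

(* Tangent spaces of B x T^r are identified with R^(q + r) by the flat
   trivialisation, with H = R^q x 0 and V = 0 x R^r. *)
Section Splitting.
Variables (R : realType) (q r : nat).
Local Notation vec := 'rV[R]_(q + r).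
Local Notation frame := 'M[R]_(q, q + r).
Implicit Types (p : set frame) (alpha : frame -> R^o).

Definition pH k (A : 'M[R]_(k, q + r)) : 'M[R]_(k, q + r) :=
  row_mx (lsubmx A) 0.

Definition pV k (A : 'M[R]_(k, q + r)) : 'M[R]_(k, q + r) :=
  row_mx 0 (rsubmx A).

Definition hbasis (i : 'I_q) : vec := row_mx (delta_mx 0 i) 0.

Definition vbasis (a : 'I_r) : vec := row_mx 0 (delta_mx 0 a).

Definition horizontal_plane : set frame := oplane_of (row_mx 1%:M 0).

(* G_H^+(q, M), where H is oriented by alpha. *)
Definition GHplus alpha p : Prop :=
  oriented_plane p /\
  forall A, p A -> row_free (pH A) /\ 0 < alpha (pH A).

Definition gH (v w : vec) : R := dotv (pH v) (pH w).

Definition vertical_energy p : R :=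
  let A := get [set A | p A /\ gram gH A = 1%:M] in
  2^-1 * \sum_(i < q) dotv (pV (row i A)) (pV (row i A)).

(* vol^H_p / vol_p, a quotient of top-degree forms on p. *)
Definition vol_ratio p : R :=
  let A := get p in vol gH A / vol (@dotv R (q + r)) A.

(* T_p = (p_V|_p) o (p_H|_p)^-1, for h in H. *)
Definition plane_map p (h : vec) : vec :=
  pV (get [set w | plane_span p w /\ pH w = h]).

Definition wedge1 (a b : vec -> R) (X Y : vec) : R := a X * b Y - a Y * b X.

Definition beta p (X Y : vec) : R :=
  \sum_(i < q) wedge1 (fun Z => dotv (hbasis i) Z)
                      (fun Z => dotv (plane_map p (hbasis i)) Z) X Y.

(* The component of type Lambda^(q - k) H^* (x) Lambda^k V^*: the terms, in the
   expansion of w (p_H v_1 + p_V v_1, ..., p_H v_q + p_V v_q), in which exactly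
   k arguments are vertical. *)
Definition component (W : lmodType R) (k : nat) (w : frame -> W) (A : frame) :
    W :=
  \sum_(I : {set 'I_q} | #|I| == k)
    w (\matrix_(i < q) (if i \in I then pV (row i A) else pH (row i A))).

Definition positive_onb_H alpha (e : frame) : Prop :=
  [/\ pH e = e, gram (@dotv R (q + r)) e = 1%:M & 0 < alpha e].

(* The element of H^* (x) V corresponding by the metric to the H^* (x) V^*
   part of a 2-form b. *)
Definition sharpV (b : vec -> vec -> R) (h : vec) : vec :=
  \sum_(a < r) b h (vbasis a) *: vbasis a.

Definition Pmap (E : vectType R) (chi : frame -> E) (e : frame)
    (b : vec -> vec -> R) : E :=
  \sum_(i < q) chi (\matrix_(j < q)
                      (if j == i then sharpV b (row i e) else row j e)).

(* The complex-linear extension, E (x) C being written as E * E, that is,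
   (real part, imaginary part). *)
Definition PmapC (E : vectType R) (chi : frame -> E) (e : frame)
    (F : vec -> vec -> R[i]) : E * E :=
  (Pmap chi e (fun X Y => complex.Re (F X Y)),
   Pmap chi e (fun X Y => complex.Im (F X Y))).

End Splitting.

Section Tori.
Variable R : realType.

Definition lattice_rel (c : R) r (x y : 'rV[R]_r) : bool :=
  `[< exists k : 'rV[int]_r, y - x = c *: map_mx intr k >].

Lemma lattice_rel_equiv c r :
  [/\ reflexive (@lattice_rel c r), symmetric (@lattice_rel c r) &
      transitive (@lattice_rel c r)].
Proof.
have sym x y : @lattice_rel c r x y -> @lattice_rel c r y x.
  move=> /asboolP[k xyk]; apply/asboolP; exists (- k).
  by rewrite raddfN /= scalerN -xyk opprB.
split.
- by move=> x; apply/asboolP; exists 0; rewrite subrr raddf0 scaler0.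
- by move=> x y; apply/idP/idP; apply: sym.
- move=> y x z /asboolP[k xyk] /asboolP[l yzl]; apply/asboolP; exists (l + k).
  by rewrite raddfD /= scalerDr -xyk -yzl addrA subrK.
Qed.

Definition lattice_equiv (c : R) r : equiv_rel 'rV[R]_r :=
  let: And3 rr rs rt := lattice_rel_equiv c r in
  EquivRel (@lattice_rel c r) rr rs rt.

(* R^r / c Z^r: T^r is torus (2 * pi) r, and the dual torus (T^r)^*, in the
   coordinates y of the dual basis, is torus 1 r. *)
Definition torus (c : R) (r : nat) : Type := {eq_quot (lattice_equiv c r)}%qT.

Definition tproj (c : R) r (x : 'rV[R]_r) : torus c r :=
  (\pi_({eq_quot (lattice_equiv c r)}) x)%qT.

Definition trepr (c : R) r (t : torus c r) : 'rV[R]_r :=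
  repr (t : {eq_quot (lattice_equiv c r)}%qT).

(* C^infinity on an open set: all iterated directional derivatives are
   differentiable there. *)
Definition smooth_on n m (U : set 'rV[R]_n) (f : 'rV[R]_n -> 'rV[R]_m) : Prop :=
  forall (vs : seq 'rV[R]_n) x, U x ->
    differentiable (foldr (fun v g => 'D_v g) f vs) x.

Definition smooth_lift c n r (U : set 'rV[R]_n) (f : 'rV[R]_n -> torus c r)
    (v : 'rV[R]_n -> 'rV[R]_r) : Prop :=
  smooth_on U v /\ forall x, U x -> tproj c (v x) = f x.

(* The smooth structure of the torus is the one for which the covering
   R^r -> R^r / c Z^r is a local diffeomorphism. *)
Definition smooth_torus_map c n r (B : set 'rV[R]_n)
    (f : 'rV[R]_n -> torus c r) : Prop :=
  forall b, B b -> exists U : set 'rV[R]_n,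
    [/\ open U, U b & exists v, smooth_lift U f v].

Definition contractible n (B : set 'rV[R]_n) : Prop :=
  exists2 x0, B x0 & exists h : 'rV[R]_n * R -> 'rV[R]_n,
    [/\ {within B `*` [set` `[0, 1]], continuous h},
        forall x t, B x -> t \in `[0, 1] -> B (h (x, t)),
        forall x, B x -> h (x, 0) = x &
        forall x, B x -> h (x, 1) = x0].

(* The differential of a map to a torus, the tangent spaces of the torus being
   identified with R^r: it is the differential of a local lift (two local lifts
   differentiable at x differ by a constant near x when c != 0). *)
Definition torus_diff c n r (f : 'rV[R]_n -> torus c r) (x w : 'rV[R]_n) :
    'rV[R]_r :=
  let v := get [set v : 'rV[R]_n -> 'rV[R]_r | differentiable v x /\
                \forall y \near x, tproj c (v y) = f y] in
  'd v x w.

Definition prod_diff c n q r (f : 'rV[R]_n -> 'rV[R]_q * torus c r)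
    (x w : 'rV[R]_n) : 'rV[R]_(q + r) :=
  row_mx ('d (fun y => (f y).1) x w) (torus_diff (fun y => (f y).2) x w).

(* The covering of R^q x torus c r by R^(q + r), and a point in each fibre. *)
Definition covering c q r (z : 'rV[R]_(q + r)) : 'rV[R]_q * torus c r :=
  (lsubmx z, tproj c (rsubmx z)).

Definition base_point c q r (m : 'rV[R]_q * torus c r) : 'rV[R]_(q + r) :=
  row_mx m.1 (trepr m.2).

End Tori.

Section Immersion.
Variables (R : realType) (q r : nat).
Local Notation frame := 'M[R]_(q, q + r).
Local Notation M := ('rV[R]_q * torus (2 * pi : R) r)%type.

(* f_* (T_b B), where B is an open subset of R^q with its standard
   orientation. *)
Definition tangent_plane (f : 'rV[R]_q -> M) (b : 'rV[R]_q) : set frame :=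
  [set A | exists2 P : 'M[R]_q, 0 < \det P &
           A = \matrix_(i < q) prod_diff f b (row i P)].

Definition positive_horizontally_projectable (alpha : frame -> R^o)
    (B : set 'rV[R]_q) (f : 'rV[R]_q -> M) : Prop :=
  forall b, B b -> GHplus alpha (tangent_plane f b).

(* alpha2|_p = phi(p) vol_p for every tangent plane p of f. *)
Definition f_calibrated (alpha2 : frame -> R^o) (phi : set frame -> R)
    (B : set 'rV[R]_q) (f : 'rV[R]_q -> M) : Prop :=
  forall b, B b -> let p := tangent_plane f b in
    forall A, p A -> alpha2 A = phi p * vol (@dotv R (q + r)) A.

Definition graph_immersion (u : 'rV[R]_q -> torus (2 * pi : R) r)
    (x : 'rV[R]_q) : M :=
  (x, u x).

End Immersion.

(* Complex-valued forms on R^q x torus c r.  A connection d + A on the trivial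
   line bundle is recorded by its connection form A. *)
Section Forms.
Variables (R : realType) (q r : nat).
Local Notation vec := 'rV[R]_(q + r).

Definition form1 (c : R) := 'rV[R]_q * torus c r -> vec -> R[i].
Definition form2 (c : R) := 'rV[R]_q * torus c r -> vec -> vec -> R[i].

Definition cderive c (phi : 'rV[R]_q * torus c r -> R[i])
    (m : 'rV[R]_q * torus c r) (X : vec) : R[i] :=
  'D_X (fun z => complex.Re (phi (covering c z))) (base_point m) +i*
  'D_X (fun z => complex.Im (phi (covering c z))) (base_point m).

(* The curvature dA of d + A (A /\ A = 0 in rank one), computed on constant
   vector fields X and Y. *)
Definition curvature c (A : form1 c) : form2 c := fun m X Y =>
  cderive (A^~ Y) m X - cderive (A^~ X) m Y.

Definition Psi (m : 'rV[R]_q * torus (2 * pi : R) r) : 'rV[R]_q * torus 1 r :=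
  (m.1, tproj 1 ((2 * pi)^-1 *: trepr m.2)).

Definition Psi_diff (m : 'rV[R]_q * torus (2 * pi : R) r) (X : vec) : vec :=
  prod_diff (fun z => Psi (covering (2 * pi) z)) (base_point m) X.

Definition Psi_pullback (F : form2 1) : form2 (2 * pi) := fun m X Y =>
  F (Psi m) (Psi_diff m X) (Psi_diff m Y).

(* A is the connection form sqrt(-1) sum_a v^a(x) dy^a of the real
   Fourier-Mukai transform of u, for some choice of a lift v of u. *)
Definition real_Fourier_Mukai (B : set 'rV[R]_q)
    (u : 'rV[R]_q -> torus (2 * pi : R) r) (A : form1 1) : Prop :=
  exists2 v : 'rV[R]_q -> 'rV[R]_r, smooth_lift B u v &
    A = fun m X => 0 +i* (\sum_(a < r) v m.1 0 a * rsubmx X 0 a).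

End Forms.

(* Main.v *)
Require Import Defs.
From HB Require Import structures.
From mathcomp Require Import all_boot all_order all_algebra fingroup perm.
From mathcomp Require Import ring lra.
From mathcomp Require Import sesquilinear generic_quotient complex.
From mathcomp Require Import all_classical all_reals all_analysis.

Set Implicit Arguments.
Unset Strict Implicit.
Unset Printing Implicit Defensive.

Import Order.TTheory GRing.Theory Num.Theory.
Import numFieldNormedType.Exports.

Local Open Scope classical_set_scope.
Local Open Scope ring_scope.
Local Open Scope complex_scope.

(** Let [v] be a lift of [u] to [R^r] and let [D] be its Jacobian matrix at [b].
    The tangent plane of the immersion at [b] is spanned by the rows of the block
    matrix [(1 | D)], so it is the graph of the linear map from [H] to [V] with
    matrix [D].  Its [beta] is [sum_(i, a) D_ia dx^i /\ dz^a], where [z] are the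
    coordinates of period [2 pi] on [T^r], while the curvature is
    [sqrt(-1) sum_(i, a) D_ia dx^i /\ dy^a] with [Psi^* y = z / (2 pi)].  This
    gives the formula for [beta] (beta_graph, Psi_pullback_curvature).

    The equivalence is pointwise.  Let [e] be a positive orthonormal frame of [H]
    and [A] the frame of the graph above it, so that [pH A = e].  The equality
    property on the frames [e + t pV A] is an identity between polynomials in
    [t].  On the left are the squares of [sum_k t^k alpha_k(A)] and
    [sum_k t^k chi_k(A)]; on the right is [det (1 + t^2 S)], where [S] is the
    Gram matrix of the vertical parts.  As [alpha_0(A) = alpha(e) = 1], degree 0
    forces [chi_0(A) = 0], degree 1 then forces [alpha_1(A) = 0], and degree 2
    reads [2 alpha_2(A) + |chi_1(A)|^2 = tr S = 2 ve]
    (equality_property_second_order).  Since [vol^H] is 1 on [A], being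
    [f]-calibrated means [alpha_2(A) = ve], that is [chi_1(A) = 0], and
    [chi_1(A)] is the value of [P] at [beta] (graph_plane_f_calibrated).

    The lift [v] exists because [B] is contractible (smooth_lift_exists).  Two
    continuous lifts of the same map differ locally by a constant lattice vector
    (lifts_locally_const).  Hence [u] can be lifted along the track of each point
    under the contraction, starting from a fixed lift at the centre, and the
    endpoint depends continuously on the point (continuous_lift_exists).  A
    continuous lift differs locally by a constant from a smooth one, so it is
    smooth. *)

(** * Alternating forms *)

Section AlternatingForms.
Variables (R : realType) (k n : nat) (W : lmodType R).
Variable w : 'M[R]_(k, n) -> W.
Hypothesis w_alt : altform w.

Lemma altform_row_comb (x : 'I_k -> 'rV[R]_n) i0 b c y z :
  w (\matrix_i (if i == i0 then b *: y + c *: z else x i)) =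
  b *: w (\matrix_i (if i == i0 then y else x i)) +
  c *: w (\matrix_i (if i == i0 then z else x i)).
Proof.
apply: (w_alt.1 _ _ _ i0); first by rewrite !rowK eqxx.
  by apply/matrixP=> i j; rewrite !mxE eq_sym (negPf (neq_lift _ _)).
by apply/matrixP=> i j; rewrite !mxE eq_sym (negPf (neq_lift _ _)).
Qed.

Lemma altform_row0 (A : 'M[R]_(k, n)) i0 : row i0 A = 0 -> w A = 0.
Proof.
move=> A0; rewrite (w_alt.1 A A A i0 0 0) ?A0 ?scaler0 ?addr0 //.
by rewrite !scale0r addr0.
Qed.

Lemma altform_row_sum (J : finType) (x : 'I_k -> 'rV[R]_n) i0
    (c : J -> R) (y : J -> 'rV[R]_n) :
  w (\matrix_i (if i == i0 then \sum_j c j *: y j else x i)) =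
  \sum_j c j *: w (\matrix_i (if i == i0 then y j else x i)).
Proof.
elim/big_rec2: _ => [|j z1 z2 _ IH].
  by apply: (@altform_row0 _ i0); rewrite rowK eqxx.
have := altform_row_comb x i0 (c j) 1 (y j) z2.
by rewrite !scale1r => ->; rewrite IH.
Qed.

(** Multilinearity in all the rows at once.  The induction runs over a list of
    rows already expanded, the others being frozen at the value prescribed by
    [g]; each step splits the index functions according to their value at the
    newly expanded row. *)
Lemma altform_expand (J : finType) (c : 'I_k -> J -> R)
    (u : 'I_k -> J -> 'rV[R]_n) (g0 : {ffun 'I_k -> J}) :
  w (\matrix_i \sum_j c i j *: u i j) =
  \sum_(f : {ffun 'I_k -> J}) (\prod_i c i (f i)) *: w (\matrix_i u i (f i)).
Proof.
have step (s : seq 'I_k) : uniq s -> forall g : {ffun 'I_k -> J},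
    w (\matrix_i (if i \in s then \sum_j c i j *: u i j else u i (g i))) =
    \sum_(f : {ffun 'I_k -> J} | [forall i, (i \notin s) ==> (f i == g i)])
      (\prod_(i <- s) c i (f i)) *: w (\matrix_i u i (f i)).
  elim: s => [|i0 s IHs] /=.
    move=> _ g; rewrite (big_pred1 g) => [|f /=].
      by rewrite big_nil scale1r.
    apply/forallP/eqP => [fg|-> i]; last by rewrite eqxx.
    by apply/ffunP => i; apply/eqP: (fg i).
  case/andP=> i0s us g.
  have -> : \matrix_i (if i \in i0 :: s then \sum_j c i j *: u i j
                       else u i (g i)) =
    \matrix_i (if i == i0 then \sum_j c i0 j *: u i0 j
               else (if i \in s then \sum_j c i j *: u i j else u i (g i))).
    by apply/row_matrixP => i; rewrite !rowK in_cons; case: eqVneq => [->|].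
  rewrite altform_row_sum.
  rewrite (partition_big (fun f : {ffun 'I_k -> J} => f i0) xpredT) //=.
  apply: eq_bigr => j _.
  pose gj := [ffun i => if i == i0 then j else g i].
  have -> : \matrix_i (if i == i0 then u i0 j
               else (if i \in s then \sum_j c i j *: u i j else u i (g i))) =
            \matrix_i (if i \in s then \sum_j c i j *: u i j else u i (gj i)).
    apply/row_matrixP => i; rewrite !rowK ffunE.
    by case: eqVneq => [->|//]; rewrite (negPf i0s).
  rewrite IHs // scaler_sumr; apply: eq_big => [f|f].
    apply/forallP/andP => [fg|[/forallP fg /eqP fi0] i].
      split; last by move: (fg i0); rewrite i0s ffunE eqxx.
      apply/forallP => i; rewrite in_cons negb_or.
      apply/implyP => /andP[ni nis].
      by move: (fg i); rewrite nis ffunE (negPf ni).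
    rewrite ffunE; case: (eqVneq i i0) => [->|ni].
      by rewrite fi0 eqxx implybT.
    by move: (fg i); rewrite in_cons negb_or ni.
  move/forallP => /(_ i0); rewrite i0s ffunE eqxx /= => /eqP fi0.
  by rewrite big_cons fi0 scalerA.
have := step (enum 'I_k) (enum_uniq _) g0.
have -> : \matrix_i (if i \in enum 'I_k then \sum_j c i j *: u i j
                     else u i (g0 i)) = \matrix_i \sum_j c i j *: u i j.
  by apply/row_matrixP => i; rewrite !rowK mem_enum.
move=> ->; apply: eq_big => [f|f _]; last by rewrite big_enum.
by apply/forallP => i; rewrite mem_enum.
Qed.

Lemma altform_tperm (x : 'I_k -> 'rV[R]_n) i1 i2 : i1 != i2 ->
  w (\matrix_i x (tperm i1 i2 i)) = - w (\matrix_i x i).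
Proof.
move=> i12.
pose z a b := w (\matrix_i (if i == i1 then a else if i == i2 then b else x i)).
have z0 a : z a a = 0.
  apply: (w_alt.2 _ i1 i2 i12) => j; rewrite !mxE eqxx.
  by rewrite eq_sym (negPf i12) eqxx.
have zDl a b d : z (a + b) d = z a d + z b d.
  have := altform_row_comb (fun i => if i == i2 then d else x i) i1 1 1 a b.
  by rewrite !scale1r.
have zC a b : z a b = w (\matrix_i
    (if i == i2 then b else if i == i1 then a else x i)).
  congr w; apply/row_matrixP => i; rewrite !rowK.
  by case: eqVneq => [->|//]; rewrite (negPf i12).
have zDr a b d : z d (a + b) = z d a + z d b.
  have := altform_row_comb (fun i => if i == i1 then d else x i) i2 1 1 a b.
  by rewrite !scale1r -!zC.
have /eqP := z0 (x i1 + x i2).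
rewrite zDl !zDr !z0 add0r addr0 addrC addr_eq0 => /eqP E.
have -> : \matrix_i x (tperm i1 i2 i) =
    \matrix_i (if i == i1 then x i2 else if i == i2 then x i1 else x i).
  apply/row_matrixP => i; rewrite !rowK.
  by case: tpermP => [->|->|/eqP/negPf-> /eqP/negPf->];
    rewrite ?eqxx // eq_sym (negPf i12).
rewrite [LHS]E; congr (- w _); apply/row_matrixP => i; rewrite !rowK.
by case: eqVneq => [->//|_]; case: eqVneq => [->|].
Qed.

Lemma altform_perm (s : 'S_k) (x : 'I_k -> 'rV[R]_n) :
  w (\matrix_i x (s i)) = (-1) ^+ s *: w (\matrix_i x i).
Proof.
have [ts -> ts_neq] := prod_tpermP s.
elim: ts ts_neq x => [_|t ts IHts /= /andP[t12 /IHts{}IHts]] x.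
  rewrite big_nil odd_perm1 scale1r; congr w.
  by apply/row_matrixP => i; rewrite !rowK perm1.
rewrite big_cons odd_permM odd_tperm t12 addTb signrN /=.
have -> : \matrix_i x ((tperm t.1 t.2 * \prod_(j <- ts) tperm j.1 j.2)%g i) =
   \matrix_i x ((\prod_(j <- ts) tperm j.1 j.2)%g (tperm t.1 t.2 i)).
  by apply/row_matrixP => i; rewrite !rowK permM.
rewrite (altform_tperm (fun i => x ((\prod_(j <- ts) tperm j.1 j.2)%g i)) t12).
by rewrite (IHts x) scaleNr.
Qed.

(** In the expansion, an index function that repeats a row contributes nothing;
    the others are permutations, whose signs produce the Leibniz formula. *)
Lemma altform_mulmx (P : 'M[R]_k) (A : 'M[R]_(k, n)) :
  w (P *m A) = \det P *: w A.
Proof.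
have -> : P *m A = \matrix_i \sum_j P i j *: row j A.
  by apply/row_matrixP => i; rewrite rowK row_mul mulmx_sum_row;
     apply: eq_bigr => j _; rewrite mxE.
rewrite (altform_expand _ _ [ffun i => i]).
rewrite (bigID (fun f : {ffun _} => injectiveb f)) /=.
rewrite [X in _ + X]big1 ?addr0 => [|f]; last first.
  case/injectivePn => i1 [i2 i12 f12].
  rewrite (w_alt.2 _ i1 i2 i12) ?scaler0 //.
  by move=> j; rewrite !mxE f12.
rewrite (reindex (@pval _)) /=; last first.
  pose in_Sn := insubd (1%g : 'S_k).
  by exists in_Sn => /= f Uf; first apply: val_inj; apply: insubdK.
rewrite scaler_suml; apply: eq_big => [s|s _]; first by rewrite (valP s).
have -> : \matrix_i row (pval s i) A = \matrix_i row (s i) A.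
  by apply/row_matrixP => i; rewrite !rowK pvalE.
rewrite (altform_perm s (fun i => row i A)) scalerA mulrC; congr (_ * _ *: w _).
  by apply: eq_bigr => i _; rewrite pvalE.
by apply/row_matrixP => i; rewrite rowK.
Qed.
End AlternatingForms.

(** * Components of forms as polynomial coefficients *)

Section PolynomialIdentities.
Variable R : realType.

Lemma poly_horner_inj (p1 p2 : {poly R}) :
  (forall t, p1.[t] = p2.[t]) -> p1 = p2.
Proof.
move=> p12; apply/eqP; rewrite -subr_eq0; apply/eqP.
pose s := [seq (i%:R : R) | i <- iota 0 (size (p1 - p2))].
apply: (@roots_geq_poly_eq0 _ _ s).
- by apply/allP => t _; rewrite rootE hornerD hornerN p12 subrr.
- by rewrite map_inj_uniq ?iota_uniq //; apply: (mulrIn (oner_neq0 R)).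
- by rewrite size_map size_iota.
Qed.

Lemma coef01_prod_1DXc (I : finType) (c : I -> R) :
  let p := \prod_i (1 + 'X * (c i)%:P) in p`_0 = 1 /\ p`_1 = \sum_i c i.
Proof.
rewrite /=.
elim/big_rec2: _ => [|i s p _ [p0 p1]]; first by rewrite !coef1.
rewrite !mulrDl !mul1r -mulrA !coefD !coefXM !coefCM /= p0 p1.
by rewrite mulr1 addr0 addrC.
Qed.

(** In the Leibniz formula, a permutation other than the identity moves at least
    two indices, so its term is divisible by [X^2]; the identity contributes the
    product of the [1 + S i i X]. *)
Lemma coef01_det_1DXS k (S : 'M[R]_k) :
  let p := \det (1%:M + 'X *: map_mx polyC S) in p`_0 = 1 /\ p`_1 = \tr S.
Proof.
rewrite /=.
pose F (s : 'S_k) := \prod_i ((i == s i)%:R + 'X * (S i (s i))%:P).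
have -> : \det (1%:M + 'X *: map_mx polyC S) = F 1%g +
    \sum_(s : 'S_k | s != 1%g) (-1) ^+ s * F s.
  rewrite /determinant (bigD1 1%g) //= odd_perm1 mul1r; congr (_ + _).
    by apply: eq_bigr => i _; rewrite !mxE.
  by apply: eq_bigr => s _; congr (_ * _); apply: eq_bigr => i _; rewrite !mxE.
have [F0 F1] := coef01_prod_1DXc (fun i => S i i).
have {}F1E : F 1%g = \prod_i (1 + 'X * (S i i)%:P).
  by apply: eq_bigr => i _; rewrite perm1 eqxx.
have rest m : (m < 2)%N -> (\sum_(s : 'S_k | s != 1%g) (-1) ^+ s * F s)`_m = 0.
  move=> m2; rewrite coef_sum big1 // => s s1.
  have [i si] : exists i, s i != i.
    apply/existsP; apply: contra_neqT s1; rewrite negb_exists => /forallP si.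
    by apply/permP => i; rewrite perm1; apply/eqP; move: (si i); rewrite negbK.
  have ssi : s i != s (s i) by rewrite (inj_eq perm_inj) eq_sym.
  rewrite /F (bigD1 i) //= (bigD1 (s i)) //=.
  rewrite eq_sym (negPf si) (negPf ssi) !add0r.
  set Q := \prod_(_ < _ | _) _.
  have -> : (-1) ^+ s * ('X * (S i (s i))%:P *
                         ('X * (S (s i) (s (s i)))%:P * Q)) =
     'X^2 * ((-1) ^+ s * (S i (s i))%:P * (S (s i) (s (s i)))%:P * Q)
     :> {poly R}.
    have gen (K : comPzRingType) (x a b c d : K) :
        a * (x * b * (x * c * d)) = x * x * (a * b * c * d) by ring.
    exact: gen.
  by rewrite coefXnM m2.
by rewrite F1E !coefD !rest // F0 F1 !addr0.
Qed.

End PolynomialIdentities.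

Section Components.
Variables (R : realType) (q r : nat).
Local Notation frame := 'M[R]_(q, q + r).

Lemma row_pH k (A : 'M[R]_(k, q + r)) i : row i (pH A) = pH (row i A).
Proof.
rewrite /pH row_row_mx row0; congr row_mx.
by apply/rowP => j; rewrite !mxE.
Qed.

Lemma row_pV k (A : 'M[R]_(k, q + r)) i : row i (pV A) = pV (row i A).
Proof.
rewrite /pV row_row_mx row0; congr row_mx.
by apply/rowP => j; rewrite !mxE.
Qed.

Lemma pH_mulmx k l (P : 'M[R]_(l, k)) (A : 'M[R]_(k, q + r)) :
  pH (P *m A) = P *m pH A.
Proof. by rewrite /pH mul_mx_row mulmx0 mulmx_lsub. Qed.

Lemma pV_mulmx k l (P : 'M[R]_(l, k)) (A : 'M[R]_(k, q + r)) :
  pV (P *m A) = P *m pV A.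
Proof. by rewrite /pV mul_mx_row mulmx0 mulmx_rsub. Qed.

(** An index function into [bool] selects the rows whose vertical part is taken,
    so grouping the terms of the multilinear expansion by the number of selected
    rows makes the components appear as the coefficients of the powers of [t].
    The number [N] of terms may exceed [q + 1]: components beyond [q] are empty
    sums. *)
Lemma altform_component_expand (W : lmodType R) (w : frame -> W) N
    (A : frame) (t : R) : altform w -> (q < N)%N ->
  w (pH A + t *: pV A) = \sum_(m < N) t ^+ m *: component m w A.
Proof.
move=> w_alt qN.
pose c (i : 'I_q) (b : bool) := if b then t else 1.
pose u (i : 'I_q) (b : bool) := if b then pV (row i A) else pH (row i A).
have -> : pH A + t *: pV A = \matrix_i \sum_b c i b *: u i b.
  apply/row_matrixP => i; rewrite rowK linearD linearZ /= row_pH row_pV.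
  by rewrite big_bool /= scale1r addrC.
rewrite (altform_expand w_alt _ _ [ffun => true]).
rewrite (reindex (fun I : {set 'I_q} => [ffun i => i \in I])) /=; last first.
  exists (fun f : {ffun 'I_q -> bool} => [set i | f i]%SET) => [I _|f _].
    by apply/setP => i; rewrite inE ffunE.
  by apply/ffunP => i; rewrite ffunE inE.
have card_lt (I : {set 'I_q}) : (#|I| < N)%N.
  by apply: leq_ltn_trans qN; rewrite -[X in (_ <= X)%N]card_ord max_card.
rewrite (partition_big (fun I : {set 'I_q} => Ordinal (card_lt I)) xpredT) //=.
apply: eq_bigr => m _; rewrite /component scaler_sumr.
apply: eq_big => [I|I /eqP Im]; first by [].
congr (_ *: w _); last by apply/row_matrixP => i; rewrite !rowK ffunE.
rewrite (bigID (mem I)) /=.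
rewrite [X in _ * X]big1 ?mulr1 => [|i /negPf iI]; last first.
  by rewrite ffunE iI.
rewrite (eq_bigr (fun=> t)) => [|i iI]; last by rewrite ffunE iI.
by rewrite prodr_const -Im.
Qed.

Lemma component0 (W : lmodType R) (w : frame -> W) A :
  component 0 w A = w (pH A).
Proof.
rewrite /component (big_pred1 finset.set0) => [|I]; last by rewrite cards_eq0.
by congr w; apply/row_matrixP => i; rewrite rowK inE row_pH.
Qed.

Lemma component1 (W : lmodType R) (w : frame -> W) A :
  component 1 w A = \sum_i w (\matrix_j (if j == i then pV (row j A)
                                         else pH (row j A))).
Proof.
have card1E : [pred I : {set 'I_q} | #|I| == 1] =i
              [set [set i]%SET | i in 'I_q]%SET.
  by move=> I; rewrite !inE; apply/cards1P/imsetP => [[i ->]|[i _ ->]];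
    exists i.
rewrite /component (eq_bigl _ _ card1E) big_imset /=; last first.
  by move=> i j _ _; apply: finset.set1_inj.
by apply: eq_bigr => i _; congr w; apply/row_matrixP => j; rewrite !rowK inE.
Qed.

(** The components are the coefficients of the polynomial function
    [t |-> w (pH A + t pV A)], which a change of frame multiplies by the
    determinant. *)
Lemma component_mulmx (w : frame -> R^o) m (P : 'M[R]_q) A : altform w ->
  component m w (P *m A) = \det P * component m w A.
Proof.
move=> w_alt; pose p A := \poly_(i < (maxn m q).+1) (component i w A : R).
have pE B t : (p B).[t] = w (pH B + t *: pV B).
  rewrite horner_poly (altform_component_expand _ _ w_alt (N := (maxn m q).+1)).
    by apply: eq_bigr => i _; rewrite mulrC.
  by rewrite ltnS leq_maxr.
have : p (P *m A) = (\det P)%:P * p A.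
  apply: poly_horner_inj => t; rewrite hornerM hornerC !pE.
  rewrite -[RHS](altform_mulmx w_alt); congr w.
  by rewrite mulmxDr -scalemxAr pH_mulmx pV_mulmx.
move/(congr1 (fun p : {poly R} => p`_m)).
by rewrite coefCM !coef_poly ltnS leq_maxl.
Qed.

End Components.

(** * The equality property to second order *)

Section SecondOrderEquality.
Variables (R : realType) (q r : nat).
Local Notation frame := 'M[R]_(q, q + r).
Variables (E : vectType R) (dotE : {dot E for idfun}).
Variables (alpha : frame -> R^o) (chi : frame -> E).
Hypotheses (alpha_alt : altform alpha) (chi_alt : altform chi).
Hypothesis alpha_chi : equality_property dotE alpha chi.

Lemma gram_dotv k n (A : 'M[R]_(k, n)) : gram (@dotv R n) A = A *m A^T.
Proof.
apply/matrixP => i j; rewrite !mxE /dotv !mxE.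
by apply: eq_bigr => l _; rewrite !mxE.
Qed.

Lemma pH_pV_orthogonal k l (A : 'M[R]_(k, q + r)) (C : 'M[R]_(l, q + r)) :
  pH A *m (pV C)^T = 0.
Proof.
by rewrite /pH /pV tr_row_mx mul_row_col trmx0 mulmx0 mul0mx addr0.
Qed.

(** The terms of degree at most two in [t] of the equality property along the
    frames [pH A + t pV A].  Degree 0 gives [chi_0 = 0], degree 1 then gives
    [alpha_1 = 0], and degree 2 gives the stated identity, the coefficient of
    the Gram determinant being the squared norm of the vertical part. *)
Lemma equality_property_second_order (A : frame) :
  pH A *m (pH A)^T = 1%:M -> alpha (pH A) = 1 ->
  2 * component 2 alpha A + dotE (component 1 chi A) (component 1 chi A) =
  \tr (pV A *m (pV A)^T).
Proof.
move=> onA alphaA.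
have VH : pV A *m (pH A)^T = 0.
  by rewrite -[LHS]trmxK trmx_mul trmxK pH_pV_orthogonal trmx0.
pose S := pV A *m (pV A)^T.
pose a m : R := component m alpha A; pose c m := component m chi A.
(* The bound leaves room for the degrees 0, 1 and 2 whatever [q] is. *)
pose N := q.+3.
pose pa := \poly_(m < N) a m.
pose pc := \sum_(i < N) \sum_(j < N) (dotE (c i) (c j))%:P * 'X^(i + j)%N.
pose D := \det (1%:M + 'X *: map_mx polyC S).
have polyE : pa * pa + pc = D \Po 'X^2.
  apply: poly_horner_inj => t.
  have Afree : row_free (pH A + t *: pV A).
    apply/row_freeP; exists (pH A)^T.
    by rewrite mulmxDl -scalemxAl VH scaler0 addr0.
  have paE : pa.[t] = alpha (pH A + t *: pV A).
    rewrite (altform_component_expand (N := N) _ _ alpha_alt) ?ltnS ?leqnSn //.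
      by rewrite horner_poly; apply: eq_bigr => i _; rewrite mulrC.
    by rewrite ltnW // ltnW.
  have pcE : pc.[t] = dotE (chi (pH A + t *: pV A)) (chi (pH A + t *: pV A)).
    rewrite (altform_component_expand (N := N) _ _ chi_alt); last first.
      by rewrite ltnW // ltnW.
    rewrite horner_sum linear_sumlz; apply: eq_bigr => i _.
    rewrite horner_sum linear_sumr; apply: eq_bigr => j _.
    rewrite hornerM hornerC hornerXn linearZl_LR linearZr_LR /= exprD.
    by rewrite mulrC -mulrA.
  have DE : (D \Po 'X^2).[t] = \det (1%:M + t ^+ 2 *: S).
    rewrite horner_comp hornerXn /D -[LHS]/(horner_eval (t ^+ 2) _) -det_map_mx.
    congr (\det _).
    apply/matrixP => i j; rewrite !mxE /=.
    by rewrite /horner_eval hornerD hornerM hornerX -polyC_natr !hornerC.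
  rewrite hornerD hornerM DE pcE paE.
  have := alpha_chi Afree; rewrite expr2 => ->.
  rewrite /wedge_norm2 gram_dotv; congr (\det _).
  rewrite linearD linearZ /= mulmxDl !mulmxDr onA -!scalemxAl -!scalemxAr.
  by rewrite VH pH_pV_orthogonal !scaler0 addr0 add0r scalerA expr2.
have [D0 D1] := coef01_det_1DXS S.
have pcc n : pc`_n =
    \sum_(i < N) \sum_(j < N) dotE (c i) (c j) * (n == (i + j)%N)%:R.
  rewrite coef_sum; apply: eq_bigr => i _; rewrite coef_sum.
  by apply: eq_bigr => j _; rewrite coefCM coefXn.
have low (n : nat) (F : nat -> R) : (n < 3)%N ->
    (forall i, (n < i)%N -> F i = 0) -> \sum_(i < N) F i = F 0 + (F 1 + F 2).
  move=> n3 F0; rewrite !big_ord_recl big1 /= ?addr0 // => i _.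
  by rewrite F0 // (leq_trans n3).
pose G n i j := dotE (c i) (c j) * (n == (i + j)%N)%:R.
have G0 n i j : (n < i)%N || (n < j)%N -> G n i j = 0.
  move=> ij; rewrite /G (_ : n == _ = false) ?mulr0 //; apply/negP => /eqP nij.
  by move: ij; rewrite nij !ltnNge leq_addr leq_addl.
pose G3 n i := G n i 0 + (G n i 1 + G n i 2).
have pc_low n : (n < 3)%N -> pc`_n = G3 n 0 + (G3 n 1 + G3 n 2).
  move=> n3; rewrite pcc (low n (fun i => \sum_(j < N) G n i j)) //.
    by rewrite !(low n (G n _)) // => j nj; rewrite G0 ?nj ?orbT.
  by move=> i ni; rewrite big1 // => j _; rewrite G0 ?ni.
have coefE n := congr1 (fun p : {poly R} => p`_n) polyE.
have paE n : (n < 3)%N -> pa`_n = a n.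
  by move=> n3; rewrite coef_poly (leq_trans n3).
have a0 : a 0 = 1 by rewrite /a component0.
have c0 : c 0 = 0.
  apply: contraTeq isT => c0N0; have := neq0_dnorm_gt0 (s := dotE) _ c0N0.
  have := coefE 0%N; rewrite coefD coefM big_ord1 !paE // pc_low //.
  rewrite coef_comp_poly_Xn //= D0 /G3 /G a0 /= !mulr0 !mulr1 !addr0.
  by move=> /eqP; rewrite -subr_eq0 addrAC subrr add0r => /eqP->; rewrite ltxx.
have a1 : a 1 = 0.
  have := coefE 1%N.
  rewrite coefD coefM !big_ord_recl big_ord0 !paE // pc_low //.
  rewrite coef_comp_poly_Xn //= /G3 /G a0 /= c0 !linear0l !linear0r /=.
  by rewrite subn0; lra.
have := coefE 2%N; rewrite coefD coefM !big_ord_recl big_ord0 !paE // pc_low //.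
rewrite coef_comp_poly_Xn //= D1 /G3 /G a0 a1 /= c0 !linear0l !linear0r /=.
by rewrite ?subn0 -/S -/(a 2) -/(c 1) => <-; ring.
Qed.

End SecondOrderEquality.

(** * Planes that are graphs over the horizontal space *)

Section GraphPlanes.
Variables (R : realType) (q r : nat).
Local Notation frame := 'M[R]_(q, q + r).
Local Notation vec := 'rV[R]_(q + r).

(** The frame of the graph of the linear map [H -> V] with matrix [D] that lies
    above the standard basis of [H]. *)
Definition graph_frame (D : 'M[R]_(q, r)) : frame := row_mx 1%:M D.

Definition graph_plane (D : 'M[R]_(q, r)) : set frame :=
  oplane_of (graph_frame D).

Lemma mul_graph_frame k (P : 'M[R]_(k, q)) D :
  P *m graph_frame D = row_mx P (P *m D).
Proof. by rewrite mul_mx_row mulmx1. Qed.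

Lemma pH_mul_graph k (P : 'M[R]_(k, q)) D :
  pH (P *m graph_frame D) = row_mx P 0.
Proof. by rewrite /pH mul_graph_frame row_mxKl. Qed.

Lemma pV_mul_graph k (P : 'M[R]_(k, q)) D :
  pV (P *m graph_frame D) = row_mx 0 (P *m D).
Proof. by rewrite /pV mul_graph_frame row_mxKr. Qed.

Lemma mul_row_mx_tr k l (A : 'M[R]_(k, q)) (C : 'M[R]_(k, r))
    (A' : 'M[R]_(l, q)) (C' : 'M[R]_(l, r)) :
  row_mx A C *m (row_mx A' C')^T = A *m A'^T + C *m C'^T.
Proof. by rewrite tr_row_mx mul_row_col. Qed.

Lemma graph_frame_free D : row_free (graph_frame D).
Proof.
apply/row_freeP; exists (col_mx 1%:M 0).
by rewrite mul_row_col mulmx1 mulmx0 addr0.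
Qed.

Lemma gram_gH (A : frame) : gram (@gH R q r) A = pH A *m (pH A)^T.
Proof.
by rewrite -gram_dotv; apply/matrixP => i j; rewrite !mxE !row_pH.
Qed.

Lemma vol_gH_graph (P : 'M[R]_q) D : 0 < \det P ->
  vol (@gH R q r) (P *m graph_frame D) = \det P.
Proof.
move=> P0; rewrite /vol gram_gH pH_mul_graph mul_row_mx_tr trmx0 mulmx0 addr0.
by rewrite det_mulmx det_tr -expr2 sqrtr_sqr gtr0_norm.
Qed.

Lemma graph_plane_nonempty D : graph_plane D (graph_frame D).
Proof. by exists 1%:M; rewrite ?det1 ?ltr01 ?mul1mx. Qed.

Lemma plane_map_graph D (h : vec) : pH h = h ->
  plane_map (graph_plane D) h = row_mx 0 (lsubmx h *m D).
Proof.
move=> hH; rewrite /plane_map.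
have : [set w | plane_span (graph_plane D) w /\ pH w = h]
         (lsubmx h *m graph_frame D).
  split; last by rewrite pH_mul_graph -[RHS]hH.
  by exists (graph_frame D); [apply: graph_plane_nonempty|rewrite submxMl].
move=> /getI /=.
set w := get _; move=> [[A [P P0 ->]] /submxP[z wz] wh].
rewrite wz mulmxA pH_mul_graph in wh *.
by rewrite pV_mul_graph -wh row_mxKl.
Qed.

Lemma beta_graph D (X Y : vec) : beta (graph_plane D) X Y =
  (lsubmx X *m D *m (rsubmx Y)^T) 0 0 - (lsubmx Y *m D *m (rsubmx X)^T) 0 0.
Proof.
have hb i : pH (hbasis R r i : vec) = hbasis R r i by rewrite /pH row_mxKl.
have aux (X' Y' : vec) : \sum_(i < q) dotv (hbasis R r i) X' *
    dotv (plane_map (graph_plane D) (hbasis R r i)) Y' =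
    (lsubmx X' *m D *m (rsubmx Y')^T) 0 0.
  rewrite -mulmxA mxE; apply: eq_bigr => i _; rewrite plane_map_graph //.
  rewrite /hbasis row_mxKl /dotv -{1}[X']hsubmxK -{1}[Y']hsubmxK.
  by rewrite !mul_row_mx_tr !mul0mx addr0 add0r -!rowE -row_mul !mxE.
by rewrite /beta sumrB !aux.
Qed.

Lemma sharpV_beta_graph D (h : vec) : pH h = h ->
  sharpV (beta (graph_plane D)) h = row_mx 0 (lsubmx h *m D).
Proof.
move=> hH; rewrite /sharpV.
under eq_bigr => a _.
  rewrite beta_graph /vbasis !row_mxKl !row_mxKr !mul0mx [X in _ - X]mxE subr0.
  rewrite trmx_delta -colE mxE scale_row_mx scaler0; over.
rewrite [in RHS](row_sum_delta (lsubmx h *m D)).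
elim/big_rec2: _ => [|a y z _ ->]; first by rewrite row_mx0.
by rewrite add_row_mx addr0.
Qed.

Lemma vertical_energy_graph D :
  vertical_energy (graph_plane D) = 2^-1 * \tr (D *m D^T).
Proof.
rewrite /vertical_energy; congr (_ * _).
have : [set A | graph_plane D A /\ gram (@gH R q r) A = 1%:M] (graph_frame D).
  split; first exact: graph_plane_nonempty.
  rewrite gram_gH -[graph_frame D]mul1mx pH_mul_graph mul_row_mx_tr.
  by rewrite trmx1 mulmx1 trmx0 mulmx0 addr0.
move=> /getI /=.
set A := get _; move=> [[P P0 ->]].
rewrite gram_gH pH_mul_graph mul_row_mx_tr trmx0 mulmx0 addr0 => PP.
transitivity (\tr (pV (P *m graph_frame D) *m (pV (P *m graph_frame D))^T)).
  by apply: eq_bigr => i _; rewrite -row_pV -gram_dotv mxE.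
rewrite pV_mul_graph mul_row_mx_tr mul0mx add0r trmx_mul mulmxA mxtrace_mulC.
by rewrite !mulmxA (mulmx1C PP) mul1mx.
Qed.

End GraphPlanes.

(** * Calibrated graphs *)

Section CalibratedGraphs.
Variables (R : realType) (q r : nat).
Local Notation frame := 'M[R]_(q, q + r).
Variables (E : vectType R) (dotE : {dot E for idfun}).
Variables (alpha : frame -> R^o) (chi : frame -> E).
Hypotheses (alpha_alt : altform alpha) (chi_alt : altform chi).
Hypothesis alpha_chi : equality_property dotE alpha chi.
Hypothesis alpha_H : calibrated_plane alpha (@horizontal_plane R q r).

Lemma dot_ge0 (x : E) : 0 <= dotE x x.
Proof.
have [->|/(neq0_dnorm_gt0 (s := dotE))/ltW//] := eqVneq x 0.
by rewrite linear0l.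
Qed.

Lemma dot_eq0 (x : E) : (dotE x x == 0) = (x == 0).
Proof.
apply/idP/eqP => [|->]; last by rewrite linear0l.
by apply: contraTeq => /(neq0_dnorm_gt0 (s := dotE)) /gt_eqF->.
Qed.

Lemma alpha_horizontal (P : 'M[R]_q) : alpha (row_mx P 0) = \det P.
Proof.
have -> : row_mx P 0 = P *m row_mx 1%:M 0 :> frame.
  by rewrite mul_mx_row mulmx1 mulmx0.
rewrite (altform_mulmx alpha_alt) alpha_H; last first.
  by exists 1%:M; rewrite ?det1 ?ltr01 ?mul1mx.
rewrite /vol gram_dotv mul_row_mx_tr trmx1 mulmx1 trmx0 mulmx0 addr0 det1.
by rewrite sqrtr1; apply: mulr1.
Qed.

Lemma graph_plane_GHplus D : GHplus alpha (graph_plane D).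
Proof.
split; first by exists (graph_frame D) => //; apply: graph_frame_free.
move=> _ [P P0 ->]; rewrite pH_mul_graph alpha_horizontal; split=> //.
apply/row_freeP; exists (col_mx (invmx P) 0).
by rewrite mul_row_col mulmx0 addr0 mulmxV // unitmxE unitfE gt_eqF.
Qed.

(** The Gram matrix [1 + D D^T] is invertible because it annihilates only the
    vectors [v] with [|v *m graph_frame D| = 0]; the sign of its determinant is
    read off the equality property. *)
Lemma vol_graph_frame_gt0 D : 0 < vol (@dotv R (q + r)) (graph_frame D).
Proof.
rewrite sqrtr_gt0 lt_def; apply/andP; split; last first.
  have := alpha_chi (graph_frame_free D); rewrite /wedge_norm2 => <-.
  by rewrite addr_ge0 ?dot_ge0 ?sqr_ge0.
apply/det0P => -[v v0]; rewrite gram_dotv mulmxA => /(congr1 (mulmx^~ v^T)).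
rewrite mul0mx -mulmxA -trmx_mul => /matrixP/(_ 0 0); rewrite [LHS]mxE [RHS]mxE.
under eq_bigr do rewrite [X in _ * X]mxE -expr2.
move/eqP; rewrite psumr_eq0 => [/allP vJ|i _]; last exact: sqr_ge0.
have {}vJ : v *m graph_frame D = 0.
  apply/rowP => i; rewrite [RHS]mxE; apply/eqP; rewrite -sqrf_eq0.
  exact: vJ (mem_index_enum i).
case/eqP: v0; apply: (row_free_inj (graph_frame_free D)).
by rewrite vJ mul0mx.
Qed.

Lemma vol_ratio_graph D A : graph_plane D A ->
  vol_ratio (graph_plane D) * vol (@dotv R (q + r)) A = vol (@gH R q r) A.
Proof.
have volP P : 0 < \det P -> vol (@dotv R (q + r)) (P *m graph_frame D) =
    \det P * vol (@dotv R (q + r)) (graph_frame D).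
  move=> P0; rewrite /vol !gram_dotv.
  have -> : P *m graph_frame D *m (P *m graph_frame D)^T =
            P *m (graph_frame D *m (graph_frame D)^T) *m P^T.
    by rewrite trmx_mul !mulmxA.
  rewrite !det_mulmx det_tr mulrAC -expr2 sqrtrM ?sqr_ge0 //.
  by rewrite sqrtr_sqr gtr0_norm.
have := graph_plane_nonempty D; move/getI; rewrite /vol_ratio.
set B := get _; move=> [Q Q0 ->] [P P0 ->].
rewrite !vol_gH_graph // !volP //.
have v0 := vol_graph_frame_gt0 D; field.
by rewrite !gt_eqF.
Qed.

Lemma positive_onb_HP e : positive_onb_H alpha e ->
  exists P : 'M[R]_q, [/\ e = row_mx P 0, P *m P^T = 1%:M & \det P = 1].
Proof.
case=> eH; rewrite gram_dotv -eH /pH mul_row_mx_tr trmx0 mulmx0 addr0 => PP.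
rewrite alpha_horizontal => P0; exists (lsubmx e); split=> //.
have := congr1 determinant PP.
rewrite det_mulmx det_tr det1 => /eqP; rewrite -expr2 sqrf_eq1.
by case/orP=> /eqP // PN1; move: P0; rewrite PN1 ltr0N1.
Qed.

(** The term of index [i] of either side evaluates [chi] on the frame [e] of [H]
    with its [i]-th vector moved to the vertical part of the graph over it. *)
Lemma Pmap_beta_graph (P : 'M[R]_q) D :
  Pmap chi (row_mx P 0) (beta (graph_plane D)) =
  component 1 chi (P *m graph_frame D).
Proof.
rewrite component1; apply: eq_bigr => i _; congr chi.
apply/row_matrixP => j; rewrite !rowK -row_pH -row_pV pH_mul_graph pV_mul_graph.
case: eqP => // ->; rewrite sharpV_beta_graph ?row_row_mx ?row0 ?row_mxKl.
  by rewrite -row_mul.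
by rewrite /pH row_mxKl.
Qed.

(** On the frame of the graph that lies above [e], the second-order identity
    reads [2 alpha_2 + |chi_1|^2 = 2 ve], so there the equation of
    [f]-calibrated planes says that [chi_1] vanishes.  It then holds on every
    positive frame, since a change of frame multiplies both of its sides by the
    determinant. *)
Lemma graph_plane_f_calibrated e D : positive_onb_H alpha e ->
  let p := graph_plane D in
  (forall A, p A ->
     component 2 alpha A = vertical_energy p * vol_ratio p *
                           vol (@dotv R (q + r)) A) <->
  Pmap chi e (beta p) = 0.
Proof.
move=> /positive_onb_HP[P [-> PP P1]] /=; rewrite Pmap_beta_graph.
set A := P *m graph_frame D.
have DA : \tr (pV A *m (pV A)^T) = \tr (D *m D^T).
  rewrite pV_mul_graph mul_row_mx_tr mul0mx add0r trmx_mul mulmxA mxtrace_mulC.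
  by rewrite !mulmxA (mulmx1C PP) mul1mx.
have := equality_property_second_order alpha_alt chi_alt alpha_chi (A := A).
rewrite DA pH_mul_graph mul_row_mx_tr mul0mx addr0 alpha_horizontal.
move=> /(_ PP P1) eqA; split=> [fcal|chi0 _ [Q Q0 ->]].
  have pA : graph_plane D A by exists P; rewrite ?P1 ?ltr01.
  apply/eqP; rewrite -dot_eq0; move: eqA.
  rewrite fcal // -mulrA vol_ratio_graph // vol_gH_graph ?P1 ?ltr01 //.
  by rewrite vertical_energy_graph => eqA; apply/eqP; lra.
have pQ : graph_plane D (Q *m graph_frame D) by exists Q.
move: eqA; rewrite chi0 linear0l addr0 => eqA.
rewrite -mulrA vol_ratio_graph // vol_gH_graph // vertical_energy_graph -eqA.
by rewrite !component_mulmx // P1; field.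
Qed.

End CalibratedGraphs.

(** * Local lifts to the universal cover of a torus *)

Section TorusProjection.
Variables (R : realType) (c : R) (r : nat).

Lemma tproj_eqP (x y : 'rV[R]_r) :
  tproj c x = tproj c y <-> exists k : 'rV[int]_r, y - x = c *: map_mx intr k.
Proof.
rewrite /tproj; split=> [/eqmodP|[k xyk]]; last first.
  apply/eqmodP; rewrite /lattice_equiv.
  by case: (lattice_rel_equiv c r) => ? ? ?; apply/asboolP; exists k.
rewrite /lattice_equiv.
by case: (lattice_rel_equiv c r) => ? ? ? /asboolP.
Qed.

Lemma tproj_trepr (t : torus c r) : tproj c (trepr t) = t.
Proof. exact: reprK. Qed.

Lemma tprojD_eq (x y z : 'rV[R]_r) :
  tproj c x = tproj c y -> tproj c (x + z) = tproj c (y + z).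
Proof.
move/tproj_eqP=> [k xyk]; apply/tproj_eqP; exists k.
by rewrite [x + z]addrC addrKA.
Qed.

End TorusProjection.

Section Neighbourhoods.

Lemma continuous_near_eq (T S : topologicalType) (f g : T -> S) x :
  (\forall y \near x, f y = g y) ->
  {for x, continuous f} -> {for x, continuous g}.
Proof.
move=> fg; rewrite /prop_for /continuous_at => cf.
have <- : f x = g x := nbhs_singleton fg.
exact: cvg_trans (near_eq_cvg fg) cf.
Qed.

Lemma differentiable_near_eq (R : realType) (V W : normedModType R)
    (f g : V -> W) x : (\forall y \near x, f y = g y) ->
  differentiable f x -> differentiable g x /\ 'd g x = 'd f x :> (V -> W).
Proof.
move=> fg df.
have gx : g \o shift x = cst (g x) + 'd f x +o_ (0 : V) id.
  apply/eqaddoP => e e0.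
  have := diff_locally df => /eqaddoP/(_ _ e0) fe.
  have fg0 : \forall y \near (0 : V), f (y + x) = g (y + x).
    by move: fg; rewrite (near_shift 0 x); apply: filterS => y; rewrite /= subr0.
  have fgx : f x = g x := nbhs_singleton fg.
  by apply: filterS2 fg0 fe => y /= fgy; rewrite !fctE /= -fgx -fgy.
have dg : 'd g x = 'd f x :> (V -> W).
  exact: diff_unique (diff_continuous df) gx.
split=> //; apply/diff_locallyP; rewrite dg; split=> //.
exact: diff_continuous.
Qed.

Lemma diffD_cst (R : realType) (V W : normedModType R) (f : V -> W) k x :
  differentiable f x -> forall w, 'd (f + cst k) x w = 'd f x w.
Proof.
move=> df w.
have E := congr1 (fun h : V -> W => h w) (diffD df (differentiable_cst k x)).
have E0 := congr1 (fun h : V -> W => h w) (diff_cst (V := V) k x).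
apply: etrans E _; apply: etrans (congr1 (+%R ('d f x w)) E0) _.
exact: addr0.
Qed.

End Neighbourhoods.

Section LocalLifts.
Variables (R : realType) (c : R) (r : nat).
Hypothesis c_gt0 : 0 < c.

(** Discreteness of the lattice: the difference of two continuous lifts of the
    same map is continuous with values in [c Z^r], hence locally constant. *)
Lemma lifts_locally_const (T : topologicalType) (g1 g2 : T -> 'rV[R]_r) z :
  {for z, continuous g1} -> {for z, continuous g2} ->
  (\forall y \near z, tproj c (g1 y) = tproj c (g2 y)) ->
  \forall y \near z, g1 y - g2 y = g1 z - g2 z.
Proof.
move=> c1 c2 g12.
have /filter_forall close : forall j, \forall y \near z,
    `|(g1 z - g2 z) 0 j - (g1 y - g2 y) 0 j| < c.
  move=> j; have cd : (fun y => (g1 y - g2 y) 0 j) @ z --> (g1 z - g2 z) 0 j.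
    have cg : (fun y => g1 y - g2 y) @ z --> g1 z - g2 z by apply: cvgB.
    exact: (cvg_comp _ (fun M : 'rV[R]_r => M 0 j) cg
              (@coord_continuous _ _ _ 0 j (g1 z - g2 z))).
  by move/cvgrPdist_lt: cd; apply.
have := nbhs_singleton g12; move/tproj_eqP => [k kz].
apply: filterS2 g12 close => y /tproj_eqP[l ly] small.
suff kl : k = l.
  by apply: oppr_inj; rewrite !opprB ly kz kl.
apply/rowP => j; have := small j.
have -> : (g1 z - g2 z) 0 j - (g1 y - g2 y) 0 j = c * (l 0 j - k 0 j)%:~R.
  rewrite -[g1 z - _]opprB -[g1 y - _]opprB kz ly !mxE intrB; ring.
rewrite normrM gtr0_norm // gtr_pMr // -intr_norm ltrz1.
by rewrite -[1]add0r ltzD1 normr_le0 subr_eq0 => /eqP.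
Qed.

(** By discreteness, the lift chosen in the definition of [torus_diff] differs
    from [v] by a constant near [x], so the two have the same differential. *)
Lemma torus_diff_lift n (f : 'rV[R]_n -> torus c r) x
    (v : 'rV[R]_n -> 'rV[R]_r) : differentiable v x ->
  (\forall y \near x, tproj c (v y) = f y) ->
  forall w, torus_diff f x w = 'd v x w.
Proof.
move=> dv vf w.
have := @getI _ [set v' : 'rV[R]_n -> 'rV[R]_r | differentiable v' x /\
  \forall y \near x, tproj c (v' y) = f y] v (conj dv vf).
rewrite /torus_diff; move: (get _) => v' /= [dv' v'f].
have v'v : \forall y \near x, v' y - v y = v' x - v x.
  apply: lifts_locally_const; first exact: differentiable_continuous.
    exact: differentiable_continuous.
  by apply: filterS2 vf v'f => y -> ->.
have vE : \forall y \near x, (v + cst (v' x - v x)) y = v' y.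
  by apply: filterS v'v => y /= <-; rewrite fctE addrC subrK.
have dvc : differentiable (v + cst (v' x - v x)) x by apply: differentiableD.
have [_ /(congr1 (fun h : 'rV[R]_n -> 'rV[R]_r => h w)) E] :=
  differentiable_near_eq vE dvc.
exact: etrans E (diffD_cst _ dv w).
Qed.

End LocalLifts.

Section IntervalInduction.
Variable R : realType.

(** Cousin's lemma: among the points [s] between [a] and [b] such that [P a s],
    the supremum is attained, by the local hypothesis on its left, and equals
    [b], by the local hypothesis on its right. *)
Lemma interval_induction (P : R -> R -> Prop) :
  (forall a b c, a <= b -> b <= c -> P a b -> P b c -> P a c) ->
  (forall t, exists2 d, 0 < d & forall a b,
     t - d < a -> a <= t -> t <= b -> b < t + d -> P a b) ->
  forall a b, a <= b -> P a b.
Proof.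
move=> Pcat Ploc a b ab.
pose S := [set s | a <= s <= b /\ P a s].
have Sa : S a.
  split; first by rewrite lexx ab.
  have [d d0] := Ploc a; apply; rewrite ?lexx ?ltrDl //.
  by rewrite ltrBlDr ltrDl.
have supS : has_sup S.
  by split; [exists a|exists b => s [/andP[]]].
have am : a <= sup S by apply: ub_le_sup => //; exact: supS.2.
have mb : sup S <= b by apply: ge_sup => [|s [/andP[]]//]; exists a.
have [d d0 Pd] := Ploc (sup S).
have [s [/andP[as_ sb] Ps] ms] := sup_adherent d0 supS.
have sm : s <= sup S by apply: ub_le_sup; [exact: supS.2|split=> //; apply/andP].
pose s' := Num.min b (sup S + d / 2).
have ms' : sup S <= s' by rewrite le_min mb lerDl divr_ge0 // ltW.
have s'S : S s'.
  split; first by rewrite (le_trans am ms') ge_min lexx.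
  apply: (Pcat _ s) => //; first exact: le_trans ms'.
  apply: Pd => //; rewrite gt_min; apply/orP; right.
  by rewrite ltrD2l gtr_pMr // invf_lt1 ?ltr1n.
have s'm : s' <= sup S by apply: ub_le_sup; [exact: supS.2|].
suff <- : s' = b by case: s'S.
apply/eqP; rewrite eq_le ge_min lexx /=.
move: s'm; rewrite {1}/s' ge_min => /orP[/le_trans->//|].
by rewrite gerDl leNgt divr_gt0.
Qed.

End IntervalInduction.

(** * Global lifts over a contractible set *)

Section HomotopyLifting.
Variables (R : realType) (c : R) (n r : nat).
Hypothesis c_gt0 : 0 < c.
Local Notation pt := ('rV[R]_n * R)%type.
Variables (B : set 'rV[R]_n) (u : 'rV[R]_n -> torus c r).
Variable H : pt -> 'rV[R]_n.
Hypotheses (B_open : open B) (H_B : forall z, B z.1 -> B (H z))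
  (H_cont : forall z, B z.1 -> {for z, continuous H}).
Hypothesis u_smooth : smooth_torus_map B u.

Lemma near_B x : B x -> \forall y \near x, B y.
Proof. by move=> Bx; apply: open_nbhs_nbhs (conj B_open Bx). Qed.

(** The two conditions are imposed on a whole neighbourhood of [z], so that the
    predicate is open in [z] and depends on the germ of [G] at [z] only. *)
Definition lift_near (G : pt -> 'rV[R]_r) (z : pt) : Prop :=
  \forall y \near z, {for y, continuous G} /\ tproj c (G y) = u (H y).

Lemma lift_near_eq G G' z : (\forall y \near z, G y = G' y) ->
  lift_near G z -> lift_near G' z.
Proof.
move=> /nbhs_interior GG'; apply: filterS2 GG' => y GG' [Gc Gu].
split; first exact: continuous_near_eq GG' Gc.
by rewrite -Gu (nbhs_singleton GG').
Qed.

Lemma lift_near_shift G z (k : 'rV[R]_r) : tproj c k = tproj c 0 ->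
  lift_near G z -> lift_near (fun y => G y + k) z.
Proof.
move=> k0; apply: filterS => y [Gc Gu]; split.
  by apply: cvgD => //; exact: cvg_cst.
by rewrite -Gu addrC (tprojD_eq _ k0) add0r.
Qed.

Lemma lift_near_const G G' z : lift_near G z -> lift_near G' z ->
  \forall y \near z, G y - G' y = G z - G' z.
Proof.
move=> Gz G'z; apply: (lifts_locally_const c_gt0).
- by case: (nbhs_singleton Gz).
- by case: (nbhs_singleton G'z).
- by apply: filterS2 Gz G'z => y [_ ->] [_ ->].
Qed.

Lemma near_slice (x : 'rV[R]_n) (t : R) (P : set pt) :
  (\forall y \near (x, t), P y) -> \forall s \near t, P (x, s).
Proof. by move=> zP; apply: (cvg_pair (f := cst x) (cvg_cst x) cvg_id) zP. Qed.

Lemma near_slice1 (x : 'rV[R]_n) (t : R) (P : set pt) :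
  (\forall y \near (x, t), P y) -> \forall y \near x, P (y, t).
Proof. by move=> zP; apply: (cvg_pair (g := cst t) cvg_id (cvg_cst t)) zP. Qed.

Lemma nearR_interval (P : set R) (t : R) : (\forall s \near t, P s) ->
  exists2 d, 0 < d & forall s, t - d < s -> s < t + d -> P s.
Proof.
move=> /nbhs_ballP[d d0 dP]; exists d => // s s1 s2; apply: dP.
by rewrite -ball_normE /= distrC ltr_distl s1 s2.
Qed.

(** A local smooth lift of [u], composed with [H]. *)
Lemma lift_near_exists z : B z.1 -> exists G, lift_near G z.
Proof.
move=> Bz; have [U [Uo Uz [w [w_smooth wu]]]] := u_smooth (H_B Bz).
exists (w \o H).
have nB : \forall y \near z, B y.1.
  have : (fun y : pt => y.1) @ z --> z.1 by apply: cvg_fst.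
  by apply; apply: open_nbhs_nbhs.
have nU : \forall y \near z, U (H y).
  by apply: (H_cont Bz); apply: open_nbhs_nbhs.
apply: filterS2 nB nU => y By Uy; split; last exact: wu.
apply: continuous_comp; first exact: H_cont.
by apply: differentiable_continuous; apply: (w_smooth [::]).
Qed.

(** Two lifts over adjacent intervals differ, near the common endpoint, by a
    constant lattice vector; translating the second one by it glues them. *)
Lemma lift_along x : B x ->
  exists G, forall t, 0 <= t <= 1 -> lift_near G (x, t).
Proof.
move=> Bx.
pose P a b := exists G, forall t, a <= t <= b -> lift_near G (x, t).
suff : P 0 1 by [].
apply: interval_induction => // [a b d ab bd [G1 G1l] [G2 G2l]|t].
  have G1b : lift_near G1 (x, b) by apply: G1l; rewrite ab lexx.
  have G2b : lift_near G2 (x, b) by apply: G2l; rewrite lexx bd.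
  pose k := G1 (x, b) - G2 (x, b).
  have k0 : tproj c k = tproj c 0.
    have [[_ e1] [_ e2]] := (nbhs_singleton G1b, nbhs_singleton G2b).
    by rewrite /k -[0](subrr (G2 (x, b))); apply: tprojD_eq; rewrite e1 e2.
  have sndc (t : R) (A : set R) : nbhs t A -> \forall y \near (x, t), A y.2.
    exact: (@cvg_snd _ _ (nbhs x) (nbhs t) _).
  exists (fun y => if y.2 <= b then G1 y else G2 y + k) => t /andP[a_t td].
  have [tb|bt|->] := ltgtP t b.
  - apply: (@lift_near_eq G1); last by apply: G1l; rewrite a_t ltW.
    by apply: filterS (sndc t [set s | s < b] (lt_nbhsl tb)) => y /ltW ->.
  - apply: (@lift_near_eq (fun y => G2 y + k)).
      apply: filterS (sndc t [set s | b < s] (lt_nbhsr bt)) => y /= by2.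
      by rewrite leNgt by2.
    by apply: lift_near_shift => //; apply: G2l; rewrite td ltW.
  - apply: (@lift_near_eq G1) => //.
    apply: filterS (lift_near_const G1b G2b) => y yE.
    by case: ifP => // _; rewrite /k -yE addrC subrK.
have [G /nbhs_interior /near_slice /nearR_interval[d d0 Gd]] :=
  @lift_near_exists (x, t) Bx.
exists d => // a b ta a_t tb bt; exists G => s /andP[as_ sb].
by apply: Gd; [apply: lt_le_trans as_|apply: le_lt_trans bt].
Qed.

Variable x0 : 'rV[R]_n.
Hypotheses (H_at0 : forall x, B x -> H (x, 0) = x0)
  (H_at1 : forall x, B x -> H (x, 1) = x).

(** At time 0 the homotopy is constant, so a lift can be normalised there on a
    whole neighbourhood; this is what makes lifts comparable at time 1. *)
Definition based_lift x (G : pt -> 'rV[R]_r) : Prop :=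
  (forall t, 0 <= t <= 1 -> lift_near G (x, t)) /\
  \forall y \near x, G (y, 0) = trepr (u x0).

Lemma based_lift_exists x : B x -> exists G, based_lift x G.
Proof.
move=> Bx; have [G Gl] := lift_along Bx.
have G0 : lift_near G (x, 0) by apply: Gl; rewrite lexx ler01.
pose k := trepr (u x0) - G (x, 0).
have k0 : tproj c k = tproj c 0.
  rewrite /k -(subrr (G (x, 0))); apply: tprojD_eq.
  by rewrite tproj_trepr (nbhs_singleton G0).2 H_at0.
exists (fun y => G y + k); split=> [t t01|].
  by apply: lift_near_shift => //; apply: Gl.
have nB := near_B Bx.
have [Gc _] := nbhs_singleton G0.
have G0c : {for x, continuous (fun y => G (y, 0))}.
  by move=> A /Gc; apply: (near_slice1 (P := fun z => A (G z))).
have : \forall y \near x, tproj c (G (y, 0)) = tproj c (trepr (u x0)).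
  apply: filterS2 nB (near_slice1 G0) => y By [_ ->].
  by rewrite tproj_trepr H_at0.
have cc : {for x, continuous (cst (trepr (u x0)) : 'rV[R]_n -> 'rV[R]_r)}.
  exact: cst_continuous.
move=> /(lifts_locally_const c_gt0 G0c cc); apply: filterS => y /=.
by move=> /eqP; rewrite subr_eq subrK => /eqP ->; rewrite /k addrC subrK.
Qed.

(** The tube lemma along the segment [{x} * [0, 1]]. *)
Lemma based_lift_near x G : B x -> based_lift x G ->
  \forall y \near x, based_lift y G.
Proof.
move=> Bx [Gl /nbhs_interior G0].
have : compact `[0 : R, 1] by apply: segment_compact.
move/compact_near_coveringP => /(_ _ (nbhs x) (fun y t => lift_near G (y, t))).
move=> /(_ _ _) cov.
have : \forall y \near x, `[0 : R, 1] `<=` (fun t => lift_near G (y, t)).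
  apply: cov => t; rewrite /= in_itv /= => /Gl /nbhs_interior [[U V] [xU tV] UV].
  by exists (V, U) => //= -[s y] [sV yU]; apply: (UV (y, s)).
by apply: filterS2 G0 => y G0y Gy; split=> // t t01; apply: Gy; rewrite /= in_itv.
Qed.

Lemma based_lift_unique x G G' : B x -> based_lift x G -> based_lift x G' ->
  G (x, 1) = G' (x, 1).
Proof.
move=> Bx [Gl G0] [G'l G'0].
pose D t := G (x, t) - G' (x, t).
suff : 0 <= 0 :> R -> 1 <= 1 :> R -> D 0 = D 1.
  move=> /(_ (lexx _) (lexx _)).
  rewrite /D (nbhs_singleton G0) (nbhs_singleton G'0) subrr => /esym/eqP.
  by rewrite subr_eq0 => /eqP.
apply: (interval_induction (P := fun a b => 0 <= a -> b <= 1 -> D a = D b)) => //.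
  move=> a b d ab bd Dab Dbd a0 d1.
  by rewrite Dab ?(le_trans bd) // Dbd // (le_trans a0).
move=> t; have [t01|t01] := boolP (0 <= t <= 1); last first.
  exists 1 => // a b _ a_t tb _ a0 b1; case/negP: t01.
  by rewrite (le_trans a0 a_t) (le_trans tb b1).
have := lift_near_const (Gl t t01) (G'l t t01).
move=> /near_slice /nearR_interval[d d0 Dd]; exists d => // a b ta a_t tb bt _ _.
have DE s : t - d < s -> s < t + d -> D s = D t by move=> *; apply: Dd.
have ad : a < t + d by apply: le_lt_trans a_t _; rewrite ltrDl.
have db : t - d < b by apply: lt_le_trans tb; rewrite ltrBlDr ltrDl.
by rewrite (DE a) ?(DE b).
Qed.

(** The value at [x] is the endpoint of a based lift along the track of [x].  The
    same based lift serves all the points near [x], whence continuity. *)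
Lemma continuous_lift_exists : exists v : 'rV[R]_n -> 'rV[R]_r, forall x, B x ->
  {for x, continuous v} /\ tproj c (v x) = u x.
Proof.
exists (fun x => get (based_lift x) (x, 1)) => x Bx.
have [G xG] := based_lift_exists Bx.
have G1 : lift_near G (x, 1) by apply: xG.1; rewrite ler01 lexx.
have [Gc Gu] := nbhs_singleton G1.
have nB := near_B Bx.
have GE : \forall y \near x, G (y, 1) = get (based_lift y) (y, 1).
  apply: filterS2 nB (based_lift_near Bx xG) => y By yG.
  apply: based_lift_unique => //; exact: getI yG.
split; last by rewrite -(nbhs_singleton GE) Gu H_at1.
apply: continuous_near_eq GE _ => A /Gc.
exact: (near_slice1 (P := fun z => A (G z))).
Qed.

End HomotopyLifting.

Section SmoothLift.
Variable R : realType.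

(** The retraction of the line onto the unit interval, after [t |-> 1 - t].
    Composing a contraction of [B] with it extends the homotopy to the open set
    [B * R], where continuity can be checked pointwise, and makes it start at the
    point to which [B] is contracted. *)
Definition clamp_rev (t : R) : R := (1 + `|1 - t| - `|t|) / 2.

Lemma clamp_rev_itv t : clamp_rev t \in `[0, 1].
Proof.
rewrite in_itv /= /clamp_rev.
have := ler_distD t 1 0; have := ler_distD 1 t 0; have := ler_distD 0 1 t.
rewrite !subr0 !sub0r normrN normr1 (distrC t 1) => h1 h2 h3.
by apply/andP; split; lra.
Qed.

Lemma clamp_rev0 : clamp_rev 0 = 1.
Proof. by rewrite /clamp_rev subr0 normr0 normr1 subr0; field. Qed.

Lemma clamp_rev1 : clamp_rev 1 = 0.
Proof. by rewrite /clamp_rev subrr normr0 normr1 addr0 subrr mul0r. Qed.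

Lemma clamp_rev_continuous : continuous clamp_rev.
Proof.
move=> t; apply: cvgM; last exact: cvg_cst.
apply: cvgB; last by apply: cvg_norm; exact: cvg_id.
apply: cvgD; first exact: cvg_cst.
by apply: cvg_norm; apply: cvgB; [exact: cvg_cst|exact: cvg_id].
Qed.

Lemma foldr_derive_near_eq (V W : normedModType R) (f g : V -> W) (x : V)
    (vs : seq V) :
  (\forall y \near x, f y = g y) ->
  \forall y \near x, foldr (fun v h => 'D_v h) f vs y =
                     foldr (fun v h => 'D_v h) g vs y.
Proof.
move=> fg; elim: vs => [//|v vs IH] /=.
by apply: filterS (nbhs_interior IH) => y yfg; exact: (near_eq_derive v yfg).
Qed.

Lemma foldr_derive_shift (V W : normedModType R) (f : V -> W) (k : W)
    (vs : seq V) :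
  foldr (fun v h => 'D_v h) (f + cst k) vs =
  foldr (fun v h => 'D_v h) f vs + cst (if nilp vs then k else 0).
Proof.
have Dk v (g : V -> W) l : 'D_v (g + cst l) = 'D_v g.
  apply/funext => y; rewrite /derive.
  have E : (fun s : R => s^-1 *: (((g + cst l) \o shift y) (s *: v) -
      (g + cst l) y)) = (fun s => s^-1 *: ((g \o shift y) (s *: v) - g y)).
    by apply/funext => s; rewrite /= !fctE [g y + l]addrC addrKA.
  by rewrite E.
elim: vs => [//|v vs IH] /=; rewrite IH Dk.
by apply/funext => y; rewrite !fctE addr0.
Qed.

Variables (c : R) (n r : nat) (B : set 'rV[R]_n) (u : 'rV[R]_n -> torus c r).
Hypothesis c_gt0 : 0 < c.

(** By discreteness, [v] differs locally by a constant from the smooth lifts that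
    exist locally. *)
Lemma continuous_lift_smooth (v : 'rV[R]_n -> 'rV[R]_r) : open B ->
  smooth_torus_map B u ->
  (forall x, B x -> {for x, continuous v} /\ tproj c (v x) = u x) ->
  smooth_lift B u v.
Proof.
move=> B_open us vlift; split=> [vs x Bx|x Bx]; last by case: (vlift x Bx).
have [U [Uo Ux [w [ws wu]]]] := us x Bx.
have nU : \forall y \near x, U y by apply: open_nbhs_nbhs (conj Uo Ux).
have nB : \forall y \near x, B y by apply: open_nbhs_nbhs (conj B_open Bx).
have vw : \forall y \near x, v y - w y = v x - w x.
  apply: (lifts_locally_const c_gt0) (vlift x Bx).1 _ _.
    by apply: differentiable_continuous; apply: (ws [::]).
  by apply: filterS2 nU nB => y Uy By; rewrite wu // (vlift y By).2.
have wv : \forall y \near x, (w + cst (v x - w x)) y = v y.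
  by apply: filterS vw => y /= <-; rewrite fctE addrC subrK.
have wsk : differentiable
    (foldr (fun v h => 'D_v h) (w + cst (v x - w x)) vs) x.
  by rewrite foldr_derive_shift; apply: differentiableD => //; apply: ws.
exact: (differentiable_near_eq (foldr_derive_near_eq vs wv) wsk).1.
Qed.

Lemma smooth_lift_exists : open B -> contractible B -> smooth_torus_map B u ->
  exists v, smooth_lift B u v.
Proof.
move=> B_open [x0 _ [h [h_cont h_B h0 h1]]] us.
pose psi (z : 'rV[R]_n * R) := (z.1, clamp_rev z.2).
have psi_cont z : psi y @[y --> z] --> psi z.
  case: z => x t.
  move=> A [[P Q] /= [xP tQ] PQ]; exists (P, clamp_rev @^-1` Q) => /=.
    by split=> //; apply: clamp_rev_continuous.
  by move=> [y s] [yP sQ]; apply: (PQ (y, clamp_rev s)).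
have psi_B y : B y.1 -> (B `*` [set` `[0, 1]]) (psi y).
  by move=> By; split=> //=; exact: clamp_rev_itv.
have [||||v v_lift] := @continuous_lift_exists _ c n r c_gt0 B u (h \o psi)
    B_open _ _ us x0.
- by move=> z Bz; apply: h_B => //; exact: clamp_rev_itv.
- move=> z Bz W Wz.
  have /subspace_continuousP/(_ (psi z) (psi_B z Bz) W Wz) hW := h_cont.
  have nB : \forall y \near z, B y.1.
    case: z Bz {Wz hW} => x t Bx.
    exact: (@cvg_fst _ _ (nbhs x) (nbhs t) _) (open_nbhs_nbhs (conj B_open Bx)).
  by apply: filterS2 nB (psi_cont z _ hW) => y By; apply; exact: psi_B.
- by move=> x Bx; rewrite /= /psi /= clamp_rev0 h1.
- by move=> x Bx; rewrite /= /psi /= clamp_rev1 h0.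
by exists v; apply: continuous_lift_smooth.
Qed.

End SmoothLift.

(** * Tangent planes of graphs and curvature *)

Section GraphTangentPlanes.
Variables (R : realType) (q r : nat).
Local Notation vec := 'rV[R]_(q + r).

Lemma two_pi_gt0 : 0 < 2 * pi :> R.
Proof. by rewrite mulr_gt0 // pi_gt0. Qed.

Lemma tangent_plane_graph (u : 'rV[R]_q -> torus (2 * pi : R) r) B v b :
  open B -> smooth_lift B u v -> B b ->
  tangent_plane (graph_immersion u) b = graph_plane (jacobian v b).
Proof.
move=> Bo [vs vu] Bb.
have dv : differentiable v b by apply: (vs [::]).
have nB : \forall y \near b, B y by apply: open_nbhs_nbhs (conj Bo Bb).
have vu' : \forall y \near b, tproj (2 * pi) (v y) = u y by exact: filterS vu nB.
have E w : prod_diff (graph_immersion u) b w = w *m graph_frame (jacobian v b).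
  apply: etrans _ (esym (mul_graph_frame w (jacobian v b))).
  rewrite /prod_diff; apply: (congr2 (@row_mx R 1 q r)).
    exact: (congr1 (fun h : 'rV[R]_q -> 'rV[R]_q => h w)
              (diff_val (is_diff_def := is_diff_id b))).
  apply: etrans (torus_diff_lift two_pi_gt0 dv vu' w) _.
  exact: esym (mul_rV_lin1 ('d v b) w).
have M P : \matrix_(i < q) prod_diff (graph_immersion u) b (row i P) =
    P *m graph_frame (jacobian v b).
  by apply/row_matrixP => i; rewrite rowK E row_mul.
by apply/seteqP; split=> A [P P0 ->]; exists P; rewrite ?M.
Qed.

Lemma derive_pairing (v : 'rV[R]_q -> 'rV[R]_r) (y : 'rV[R]_r) (p X : vec) :
  derivable v (lsubmx p) (lsubmx X) ->
  'D_X (fun z => \sum_(a < r) v (lsubmx z) 0 a * y 0 a) p =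
  \sum_(a < r) 'D_(lsubmx X) v (lsubmx p) 0 a * y 0 a.
Proof.
move=> dv; apply: cvg_lim => //.
pose Q (h : R) :=
  h^-1 *: ((v \o shift (lsubmx p)) (h *: lsubmx X) - v (lsubmx p)).
have -> : (fun h : R => h^-1 *: (((fun z => \sum_(a < r) v (lsubmx z) 0 a * y 0 a)
      \o shift p) (h *: X) - \sum_(a < r) v (lsubmx p) 0 a * y 0 a)) =
    (fun h => \sum_(a < r) Q h 0 a * y 0 a).
  apply/funext => h /=; rewrite -sumrB scaler_sumr; apply: eq_bigr => a _.
  have Xp : lsubmx (h *: X + p) = h *: lsubmx X + lsubmx p.
    by rewrite linearD linearZ.
  by rewrite /Q !mxE /= Xp -mulrBl -mulrA.
apply: cvg_big => [|a _]; first exact: add_continuous.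
apply: cvgM; last exact: cvg_cst.
exact: (cvg_comp _ (fun M : 'rV[R]_r => M 0 a) dv
          (@coord_continuous _ _ _ 0 a ('D_(lsubmx X) v (lsubmx p)))).
Qed.

Lemma Psi_diffE (m : 'rV[R]_q * torus (2 * pi : R) r) (X : vec) :
  Psi_diff m X = row_mx (lsubmx X) ((2 * pi)^-1 *: rsubmx X).
Proof.
set k := (2 * pi)^-1; have k0 : 2 * pi != 0 :> R by rewrite gt_eqF ?two_pi_gt0.
rewrite /Psi_diff /prod_diff; apply: (congr2 (@row_mx R 1 q r)).
  exact: (congr1 (fun h : vec -> 'rV[R]_q => h X)
            (diff_lin (base_point m) (@continuous_lsubmx _ 1 q r))).
pose w (y : vec) := k *: (rsubmx y : 'rV[R]_r).
have dr : differentiable (rsubmx : vec -> 'rV[R]_r) (base_point m).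
  exact: differentiable_rsubmx.
have dw : differentiable w (base_point m) by apply: differentiableZ.
have wl : \forall y \near base_point m,
    tproj 1 (w y) = (Psi (covering (2 * pi) y)).2.
  apply: (@filterE _ (nbhs (base_point m))) => y; apply/tproj_eqP.
  have /tproj_eqP[l yl] := tproj_trepr (tproj (2 * pi) (rsubmx y)).
  exists (- l); rewrite /w -/k -scalerBr -opprB yl scale1r map_mxN.
  by rewrite scalerN scalerA mulVf // scale1r.
apply: etrans (torus_diff_lift ltr01 dw wl X) _.
apply: etrans (congr1 (fun h : vec -> 'rV[R]_r => h X) (diffZ k dr)) _.
exact: (congr1 (fun h : vec -> 'rV[R]_r => k *: h X)
          (diff_lin (base_point m) (@continuous_rsubmx _ 1 q r))).
Qed.

(** The right-hand side is [sqrt(-1) sum_a dv^a /\ dy^a] on [X] and [Y]: the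
    coefficients of the connection form depend on [x] only. *)
Lemma curvature_Fourier_Mukai (v : 'rV[R]_q -> 'rV[R]_r)
    (m : 'rV[R]_q * torus (1 : R) r) (X Y : vec) : differentiable v m.1 ->
  curvature (fun m X => 0 +i* (\sum_(a < r) v m.1 0 a * rsubmx X 0 a)) m X Y =
  0 +i* ((lsubmx X *m jacobian v m.1 *m (rsubmx Y)^T) 0 0 -
         (lsubmx Y *m jacobian v m.1 *m (rsubmx X)^T) 0 0).
Proof.
move=> dv.
have mE : lsubmx (base_point m) = m.1 by rewrite /base_point row_mxKl.
have cE (X' Y' : vec) : cderive
      (fun m => 0 +i* (\sum_(a < r) v m.1 0 a * rsubmx Y' 0 a)) m X' =
    0 +i* (lsubmx X' *m jacobian v m.1 *m (rsubmx Y')^T) 0 0.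
  rewrite /cderive /=; congr (_ +i* _); first exact: derive_cst.
  rewrite derive_pairing mE; last exact: diff_derivable.
  rewrite (deriveEjacobian _ dv) [RHS]mxE; apply: eq_bigr => a _.
  by rewrite [(rsubmx Y')^T a 0]mxE.
by rewrite /curvature !cE; apply/eqP; rewrite eq_complex /= subr0 !eqxx.
Qed.

(** The factor [(2 pi)^-1] is that of [Psi], whose differential rescales the
    vertical arguments; the curvature is linear in them. *)
Lemma Psi_pullback_curvature (u : 'rV[R]_q -> torus (2 * pi : R) r) B v m X Y :
  smooth_lift B u v -> B m.1 ->
  Psi_pullback (curvature (fun m X => 0 +i* (\sum_(a < r) v m.1 0 a *
                                               rsubmx X 0 a))) m X Y =
  0 +i* ((2 * pi)^-1 * beta (graph_plane (jacobian v m.1)) X Y).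
Proof.
move=> [vs _] Bm; have dv : differentiable v m.1 by apply: (vs [::]).
rewrite /Psi_pullback curvature_Fourier_Mukai // !Psi_diffE beta_graph.
rewrite !row_mxKl !row_mxKr; congr (_ +i* _).
have kE (M N : 'rV[R]_r) :
    (M *m ((2 * pi)^-1 *: N)^T) 0 0 = (2 * pi)^-1 * (M *m N^T) 0 0.
  by rewrite linearZ /= -scalemxAr mxE.
by rewrite !kE -mulrBr.
Qed.

End GraphTangentPlanes.

Lemma Pmap_scale (R : realType) (q r : nat) (E : vectType R)
    (chi : 'M[R]_(q, q + r) -> E) e k b : altform chi ->
  Pmap chi e (fun X Y => k * b X Y) = k *: Pmap chi e b.
Proof.
move=> chi_alt; rewrite /Pmap scaler_sumr; apply: eq_bigr => i _.
have -> : sharpV (fun X Y => k * b X Y) (row i e) =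
    k *: sharpV b (row i e) + 0 *: 0.
  rewrite scale0r addr0 /sharpV scaler_sumr.
  by apply: eq_bigr => a _; rewrite scalerA.
by rewrite (altform_row_comb chi_alt) scale0r addr0.
Qed.

Theorem proposition6p3 (R : realType) (q r : nat)
    (alpha : 'M[R]_(q, q + r) -> R^o)
    (E : vectType R) (dotE : {dot E for idfun})
    (chi : 'M[R]_(q, q + r) -> E)
    (B : set 'rV[R]_q) (u : 'rV[R]_q -> torus (2 * pi : R) r) :
  calibration alpha ->
  calibrated_plane alpha (@horizontal_plane R q r) ->
  altform chi ->
  equality_property dotE alpha chi ->
  open B ->
  contractible B ->
  smooth_torus_map B u ->
  let iota := graph_immersion u in
  positive_horizontally_projectable alpha B iota /\
  (exists nabla, real_Fourier_Mukai B u nabla) /\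
  forall nabla, real_Fourier_Mukai B u nabla ->
    let F := Psi_pullback (curvature nabla) in
    (forall b, B b -> forall X Y : 'rV[R]_(q + r),
      (beta (tangent_plane iota b) X Y)%:C =
        - (2 * pi)%:C * (0 +i* 1) * F (iota b) X Y) /\
    (forall e, positive_onb_H alpha e ->
      f_calibrated (component 2 alpha)
        (fun p => vertical_energy p * vol_ratio p) B iota <->
      (forall m, B m.1 -> PmapC chi e (F m) = 0)).
Proof.
move=> [alpha_alt _] alpha_H chi_alt alpha_chi B_open B_contr u_smooth iota.
have [v0 v0_lift] := smooth_lift_exists (two_pi_gt0 R) B_open B_contr u_smooth.
have tangentE v b : smooth_lift B u v -> B b ->
    tangent_plane iota b = graph_plane (jacobian v b).
  by move=> v_lift Bb; exact: (tangent_plane_graph B_open v_lift Bb).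
split; [|split].
- move=> b Bb; rewrite (tangentE v0) //.
  exact: graph_plane_GHplus.
- by exists (fun m X => 0 +i* (\sum_(a < r) v0 m.1 0 a * rsubmx X 0 a)), v0.
move=> _ [v v_lift ->] /=; set F := Psi_pullback _.
have FE m : B m.1 -> F m = fun X Y =>
    0 +i* ((2 * pi)^-1 * beta (graph_plane (jacobian v m.1)) X Y).
  by move=> Bm; apply/funext => X; apply/funext => Y;
     apply: Psi_pullback_curvature v_lift Bm.
have pi_neq0 : 2 * pi != 0 :> R by rewrite gt_eqF ?two_pi_gt0.
split=> [b Bb X Y|e e_onb].
  rewrite FE // (tangentE v) //.
  move: (2 * pi) pi_neq0 (beta _ X Y) => k k0 x.
  by apply/eqP; rewrite eq_complex /=; apply/andP; split; apply/eqP; field.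
have PmapCE m : B m.1 -> PmapC chi e (F m) = 0 <->
    Pmap chi e (beta (graph_plane (jacobian v m.1))) = 0.
  move=> Bm; rewrite /PmapC FE //=.
  have -> : Pmap chi e (fun X Y : 'rV[R]_(q + r) => 0) = 0.
    have := @Pmap_scale R q r E chi e 0 (fun _ _ => 0) chi_alt.
    rewrite scale0r => P0; rewrite -[RHS]P0; congr Pmap.
    by apply/funext => X; apply/funext => Y; rewrite mul0r.
  rewrite Pmap_scale //; split=> [[/eqP]|->]; last by rewrite scaler0.
  by rewrite scaler_eq0 invr_eq0 (negPf pi_neq0) => /eqP.
have planeE b : B b -> _ := fun Bb =>
  graph_plane_f_calibrated alpha_alt chi_alt alpha_chi alpha_H (jacobian v b)
    e_onb.
split=> [fcal m Bm|PF b Bb].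
  apply/PmapCE => //; apply/planeE => // A pA.
  by have := fcal _ Bm; rewrite /= (tangentE v) //; apply.
rewrite /= (tangentE v) //; apply/planeE => //.
by apply/(PmapCE (iota b)) => //; apply: PF.
Qed.
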